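(* Let $q$ be a prime power, $n$ a positive integer, let $\mathcal{F}\subseteq\{1,\ldots,n\}\times\{1,\ldots,n\}$ be a symmetric Ferrers diagram, and let $r\in\mathbb{Z}$. Then $$W_r(\mathrm{Sym}_q^{n\times n}[\mathcal{F}])=\sum_{\substack{t,s\ge0\\2t+s=r}}(q-1)^{t+s}\,q^{(|\mathcal{F}|-t-s)/2}\,R^{\mathrm{sym}}_{t,s}(\mathcal{F};q^{-1/2}).$$
   Context: A Ferrers diagram is a finite set $\mathcal{F}\subseteq\mathbb{N}\times\mathbb{N}$ ($\mathbb{N}$ the positive integers; $(i,j)$ = row $i$, column $j$) such that $(i,j)\in\mathcal{F}$ implies $(s,t)\in\mathcal{F}$ for all $1\le s\le i$, $1\le t\le j$; it is symmetric if $(i,j)\in\mathcal{F}$ implies $(j,i)\in\mathcal{F}$. A placement of non-attacking rooks is a set of cells no two sharing a row or column index; $\mathrm{NAR}(\mathcal{F},r)$ is the set of such placements $P\subseteq\mathcal{F}$ with $|P|=r$. For $P$, $\mathrm{ATK}(P)=\bigcup_{(a,b)\in P}\big(\{(s,b):1\le s\le a\}\cup\{(a,t):1\le t\le b\}\big)$ and $\mathrm{inv}(\mathcal{F},P)=|\mathcal{F}\setminus\mathrm{ATK}(P)|$. Let $\Xi=\{(i,i):i\in\mathbb{N}\}$. Define $\mathrm{NAR}^{\mathrm{alt}}(\mathcal{F},r)=\{P\in\mathrm{NAR}(\mathcal{F},r): (i,j)\in P\Rightarrow i\ne j\text{ and }(j,i)\in P\}$ and, for $t,s\in\mathbb{N}_0$,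 $\mathrm{NAR}^{\mathrm{sym}}(\mathcal{F},t,s)$ as the set of $P\in\mathrm{NAR}(\mathcal{F},2t+s)$ of the form $P=T\cup S$ with $T\in\mathrm{NAR}^{\mathrm{alt}}(\mathcal{F},2t)$, $S\subseteq\Xi$, $|S|=s$. The symmetric $(t,s)$-th $q$-rook polynomial is $R^{\mathrm{sym}}_{t,s}(\mathcal{F};q)=\sum_{P\in\mathrm{NAR}^{\mathrm{sym}}(\mathcal{F},t,s)}q^{\mathrm{inv}(\mathcal{F},P)}$, set to $0$ if $t<0$, $s<0$ or $\mathrm{NAR}^{\mathrm{sym}}(\mathcal{F},t,s)=\emptyset$, and with $R^{\mathrm{sym}}_{0,0}(\mathcal{F};q)=q^{|\mathcal{F}|}$; $R^{\mathrm{sym}}_{t,s}(\mathcal{F};q^{-1/2})$ denotes its evaluation at $q^{-1/2}$. $\mathrm{Sym}_q^{n\times n}[\mathcal{F}]$ is the set of symmetric $n\times n$ matrices over $\mathbb{F}_q$ with support contained in $\mathcal{F}$, and $W_r(\mathcal{C})$ is the number of matrices of rank $r$ in $\mathcal{C}$. *)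

(* Defs.v *)
From HB Require Import structures.
From mathcomp Require Import all_boot all_order all_algebra.

Set Implicit Arguments.
Unset Strict Implicit.
Unset Printing Implicit Defensive.

Import Order.TTheory GRing.Theory Num.Theory.

Local Open Scope ring_scope.

(* Row and column indices are 0-based: the cell (i, j) of {1..n} x {1..n} is
   (i - 1, j - 1) : 'I_n * 'I_n.  ATK P never leaves the n x n board, so
   rook_inv does not depend on the choice of board around a diagram. *)

Definition is_ferrers n (F : {set 'I_n * 'I_n}) : Prop :=
  forall i j : 'I_n, (i, j) \in F ->
  forall s t : 'I_n, (s <= i)%N -> (t <= j)%N -> (s, t) \in F.

Definition is_symmetric n (F : {set 'I_n * 'I_n}) : Prop :=
  forall i j : 'I_n, (i, j) \in F -> (j, i) \in F.

Definition nonattacking n (P : {set 'I_n * 'I_n}) : bool :=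
  [forall c : 'I_n * 'I_n in P, forall d : 'I_n * 'I_n in P,
     (c != d) ==> ((c.1 != d.1) && (c.2 != d.2))].

Definition NAR n (F : {set 'I_n * 'I_n}) (r : nat) :
    {set {set 'I_n * 'I_n}} :=
  [set P : {set 'I_n * 'I_n} | [&& P \subset F, nonattacking P & #|P| == r]].

Definition ATK n (P : {set 'I_n * 'I_n}) : {set 'I_n * 'I_n} :=
  \bigcup_(c in P)
    ([set (s, c.2) | s in [pred s : 'I_n | (s <= c.1)%N]] :|:
     [set (c.1, t) | t in [pred t : 'I_n | (t <= c.2)%N]]).

Definition rook_inv n (F P : {set 'I_n * 'I_n}) : nat := #|F :\: ATK P|.

Definition diagonal n : {set 'I_n * 'I_n} := [set c | c.1 == c.2].

Definition NAR_alt n (F : {set 'I_n * 'I_n}) (r : nat) :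
    {set {set 'I_n * 'I_n}} :=
  [set P : {set 'I_n * 'I_n} in NAR F r |
     [forall c : 'I_n * 'I_n in P, (c.1 != c.2) && ((c.2, c.1) \in P)]].

Definition NAR_sym n (F : {set 'I_n * 'I_n}) (t s : nat) :
    {set {set 'I_n * 'I_n}} :=
  [set P : {set 'I_n * 'I_n} in NAR F (2 * t + s)%N |
     [exists T : {set 'I_n * 'I_n} in NAR_alt F (2 * t)%N,
      exists S : {set 'I_n * 'I_n},
        [&& S \subset diagonal n, #|S| == s & P == T :|: S]]].

(* The conventions "0 when NAR_sym F t s is empty" and "q^|F| when t = s = 0"
   need no special case: the former is the empty sum, and NAR_sym F 0 0
   consists of the empty placement, whose rook_inv is #|F|. *)
Definition Rsym n (F : {set 'I_n * 'I_n}) (t s : nat) : {poly int} :=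
  \sum_(P in NAR_sym F t s) 'X^(rook_inv F P).

Definition Rsym_eval (R : nzRingType) n (F : {set 'I_n * 'I_n})
    (t s : nat) (x : R) : R :=
  (map_poly (intr : int -> R) (Rsym F t s)).[x].

Definition mxsupport (K : fieldType) n (A : 'M[K]_n) : {set 'I_n * 'I_n} :=
  [set c | A c.1 c.2 != 0].

Definition SymMx (K : finFieldType) n (F : {set 'I_n * 'I_n}) :
    {set 'M[K]_n} :=
  [set A | (A^T == A) && (mxsupport A \subset F)].

Definition rank_count (K : finFieldType) n (C : {set 'M[K]_n}) (r : int) :
    nat :=
  #|[set A in C | (\rank A)%:Z == r]|.

(* Main.v *)
Require Import Defs.
From mathcomp Require Import all_boot all_order all_algebra.
From mathcomp Require Import ring zify.
Import Order.TTheory GRing.Theory Num.Theory.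
Local Open Scope ring_scope.

Set Implicit Arguments.
Unset Strict Implicit.
Unset Printing Implicit Defensive.

(* For a set D of indices with maximum m, split the symmetric matrices A
   supported in F and in D x D by the last nonzero entry b of row m.  If row m
   is zero, drop m.  Otherwise one rank-reduction step (b = m) or two (b < m)
   clear rows and columns m and b of A; since F is a symmetric Ferrers diagram
   the correction term stays inside F, so what remains is an arbitrary matrix of
   the same kind on D minus {m, b}, while rows m and b are free up to the
   position of the last entry of row m.  Symmetric rook placements satisfy the
   same recursion: a placement is split by its rook (m, b), and the cells of
   D x D attacked by (m, b) and (b, m) but lying off the smaller board match
   the free entries.  Both sums agree by induction on D; working with subsets D
   of a fixed index set avoids renumbering after m and b are removed. *)

(** * Rank reduction, and sums split by a unique witness *)

(** Wedderburn's rank reduction: column [j] of the reduced matrix vanishes, so a multiple of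
    [row i A] lying in its row space is zero at [j], hence zero. The row space of [A] is therefore a
    direct sum. *)
Lemma mxrank_wedderburn (K : fieldType) (m n : nat) (A : 'M[K]_(m, n)) i j :
  A i j != 0 ->
  \rank A = (\rank (A - (A i j)^-1 *: (col j A *m row i A))).+1.
Proof.
move=> Aij; set B := A - _.
have eqA : (A :=: row i A + B)%MS.
  apply/eqmxP/andP; split.
    rewrite -[X in (X <= _)%MS](subrK ((A i j)^-1 *: (col j A *m row i A))) -/B.
    rewrite addmx_sub ?addsmxSr // scalemx_sub //.
    by apply: submx_trans (addsmxSl _ _); apply: submxMl.
  rewrite addsmx_sub row_sub /= addmx_sub // eqmx_opp scalemx_sub //.
  exact: submx_trans (submxMl _ _) (row_sub _ _).
have rowB : row i A != 0.
  by apply: contraNneq Aij => /rowP/(_ j); rewrite !mxE => ->.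
have cap0 : (row i A :&: B = 0)%MS.
  apply/eqP; rewrite -submx0; apply/row_subP => k.
  set v := row k _.
  have: (v <= row i A :&: B)%MS by apply: row_sub.
  rewrite sub_capmx => /andP[/sub_rVP[a va] /submxP[w vw]].
  have: (v *m delta_mx j (0 : 'I_1)) 0 0 = a * A i j.
    by rewrite -colE va !mxE.
  rewrite vw -mulmxA -colE.
  have -> : col j B = 0.
    apply/colP => l; rewrite /B !mxE big_ord1 !mxE.
    by rewrite mulrCA mulVf // mulr1 subrr.
  rewrite mulmx0 mxE => /esym/eqP; rewrite mulf_eq0 (negPf Aij) orbF => /eqP a0.
  by rewrite -vw va a0 scale0r sub0mx.
by rewrite eqA (mxrank_disjoint_sum cap0) rank_rV rowB.
Qed.

(** Serves for two kinds of witness: the last nonzero column of row m of a matrix, and the column of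
    the rook in row m of a placement. Uniqueness makes the double sum count each [x] at most
    once. *)
Lemma sum_unique_witness (R : nmodType) (T J : finType) (S : pred T)
    (Q : T -> pred J) (f : T -> R) :
  (forall x j k, S x -> Q x j -> Q x k -> j = k) ->
  \sum_(x | S x) f x =
  \sum_(x | S x && [forall j, ~~ Q x j]) f x
  + \sum_j \sum_(x | S x && Q x j) f x.
Proof.
move=> Quniq; rewrite (bigID (fun x => [forall j, ~~ Q x j])) /=; congr (_ + _).
rewrite (exchange_big_dep S) /=; last by move=> j x _ /andP[].
rewrite [RHS](bigID (fun x => [forall j, ~~ Q x j])) /= [X in _ = X + _]big1.
  rewrite add0r; apply: eq_bigr => x /andP[Sx].
  rewrite negb_forall => /existsP[j]; rewrite negbK => Qj.
  rewrite (big_pred1 j) // => k; rewrite Sx; apply/idP/eqP => [Qk|-> //].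
  exact: Quniq Qk Qj.
move=> x /andP[_ /forallP Q0]; apply: big1 => j /andP[_ Qj].
by have := Q0 j; rewrite Qj.
Qed.

(** * Objects on D x D, and symmetric matrices split by the last entry of row m *)

Definition sym_placements n (F : {set 'I_n * 'I_n}) (D : {set 'I_n}) :=
  [set P : {set 'I_n * 'I_n} | [&& P \subset F :&: setX D D, nonattacking P &
     [forall c in P, (c.2, c.1) \in P]]].

Definition below n (D : {set 'I_n}) (b : 'I_n) := [set j in D | (j < b)%N].

(* The number of choices for rows m and b of a symmetric matrix supported on
   D x D, with max D = m, whose last nonzero entry in row m is at column b. *)
Definition pivot_count (R : nzRingType) (q : R) n (D : {set 'I_n}) (m b : 'I_n) :=
  (q - 1) * q ^+ #|below D b| * (if b == m then 1 else q ^+ #|D :\ m|).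

Definition last_pivot (K : fieldType) n (A : 'M[K]_n) (m b : 'I_n) :=
  (A m b != 0) && [forall j : 'I_n, (b < j)%N ==> (A m j == 0)].

(* Equals A - A' for the rank reduction A' of A at the entries (m, b) and (b, m),
   with u and v the rows b and m of A.  For b = m, where u = v, it is
   v^T v / v b, the correction of a single reduction step. *)
Definition pivot_correction (K : fieldType) n (u v : 'I_n -> K) (b : 'I_n) :
    'M[K]_n :=
  \matrix_(i, j) ((u i * v j + v i * u j) / v b - u b * v i * v j / v b ^+ 2).

Lemma SymMxP (K : finFieldType) n (F : {set 'I_n * 'I_n}) (A : 'M[K]_n) :
  reflect ((forall i j, A i j = A j i) /\
           (forall i j, A i j != 0 -> (i, j) \in F))
          (A \in SymMx K F).
Proof.
rewrite inE; apply: (iffP andP) => [[/eqP symA /subsetP suppA]|[symA suppA]].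
  split=> i j; first by rewrite -[in LHS]symA mxE.
  by move=> Aij; apply: suppA; rewrite inE.
split; first by apply/eqP/matrixP => i j; rewrite mxE.
by apply/subsetP => -[i j]; rewrite inE; apply: suppA.
Qed.

(** When [b != m] a second reduction step, at [(b, m)], is possible because [A m m = 0] makes the
    first one leave the entry at [(b, m)] unchanged. *)
Lemma rank_pivot_correction (K : finFieldType) n (A : 'M[K]_n) (m b : 'I_n) :
  (forall i j, A i j = A j i) -> A m b != 0 -> (b != m -> A m m = 0) ->
  \rank A = (#|[set m; b]| + \rank (A - pivot_correction (A b) (A m) b)%R)%N.
Proof.
move=> symA Amb Amm; rewrite cards2 eq_sym (mxrank_wedderburn Amb).
have [bm|bm] /= := eqVneq b m.
  subst b; rewrite add1n; congr (\rank _).+1; apply/matrixP => i j.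
  by rewrite !mxE big_ord1 !mxE (symA i m); field.
set B := A - _.
have Bbm : B b m = A m b.
  by rewrite /B !mxE big_ord1 !mxE (Amm bm) !mulr0 subr0.
have Bbm0 : B b m != 0 by rewrite Bbm.
rewrite (mxrank_wedderburn Bbm0); congr (\rank _).+2; rewrite Bbm.
apply/matrixP => i j; rewrite /B !mxE !big_ord1 !mxE !big_ord1 !mxE.
by rewrite (Amm bm) (symA i m) (symA i b); field.
Qed.

(** One set of admissible values per column of row m: [family] then collects the possible rows, and
    their number is a product over columns. [free_row_family] does the same for row b. *)
Definition pivot_row_family (K : finFieldType) n (D : {set 'I_n}) (b : 'I_n)
    (j : 'I_n) : {pred K} :=
  [pred x | if j == b then x != 0 else (j \in below D b) || (x == 0)].

Definition free_row_family (K : finFieldType) n (D : {set 'I_n}) (m b : 'I_n)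
    (j : 'I_n) : {pred K} :=
  [pred x | ((b != m) && (j \in D :\ m)) || (x == 0)].

Lemma card_family_prod (T : finType) (rT : finType) (A : T -> {pred rT}) :
  #|family A| = (\prod_(x : T) #|A x|)%N.
Proof. by rewrite card_family foldrE big_map big_enum. Qed.

Lemma card_free_coordinates (K : finFieldType) (T : finType) (D : {set T}) :
  (\prod_j #|[pred x : K | (j \in D) || (x == 0%R)]|)%N = (#|K| ^ #|D|)%N.
Proof.
rewrite (bigID (mem D)) /= [X in (_ * X)%N]big1 ?muln1; last first.
  move=> j /negPf jD; rewrite -(card1 (0 : K)).
  by apply: eq_card => x; rewrite !inE jD.
rewrite -prod_nat_const; apply: eq_bigr => j jD.
by apply: eq_card => x; rewrite !inE jD.
Qed.

Lemma card_pivot_rows (K : finFieldType) n (D : {set 'I_n}) (b : 'I_n) :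
  #|family (@pivot_row_family K n D b)| = (#|K|.-1 * #|K| ^ #|below D b|)%N.
Proof.
rewrite card_family_prod (bigD1 b) //=; congr (_ * _)%N.
  rewrite -subn1 -(card1 (0 : K)) -(cardC (pred1 (0 : K))) addKn.
  by apply: eq_card => x; rewrite !inE eqxx.
rewrite -card_free_coordinates [RHS](bigD1 b) //=.
rewrite [X in (X * _)%N](_ : _ = 1%N) ?mul1n.
  apply: eq_bigr => j /negPf jb; apply: eq_card => x.
  by rewrite !inE jb.
rewrite -(card1 (0 : K)); apply: eq_card => x.
by rewrite !inE ltnn andbF.
Qed.

Lemma card_free_rows (K : finFieldType) n (D : {set 'I_n}) (m b : 'I_n) :
  #|family (@free_row_family K n D m b)| =
  (if b == m then 1 else #|K| ^ #|D :\ m|)%N.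
Proof.
rewrite card_family_prod; have [bm|bm] := eqVneq b m.
  apply: big1 => j _; rewrite -(card1 (0 : K)).
  by apply: eq_card => x; rewrite !inE bm eqxx.
rewrite -card_free_coordinates; apply: eq_bigr => j _.
by apply: eq_card => x; rewrite !inE bm.
Qed.

Lemma pivot_correction_sym (K : fieldType) n (u v : 'I_n -> K) b i j :
  pivot_correction u v b i j = pivot_correction u v b j i.
Proof. by rewrite !mxE; ring. Qed.

Lemma pivot_correction_row_b (K : fieldType) n (u v : 'I_n -> K) b j :
  v b != 0 -> pivot_correction u v b b j = u j.
Proof. by move=> vb; rewrite !mxE; field. Qed.

(** With [u] and [v] as rows b and m, the hypotheses express the symmetry of the matrix and the
    vanishing of row m beyond b. Subtracting the correction thus clears row m as well as row b. *)
Lemma pivot_correction_row_m (K : fieldType) n (u v : 'I_n -> K) m b j :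
  v b != 0 -> u m = v b -> (b = m -> u =1 v) -> (b != m -> v m = 0) ->
  pivot_correction u v b m j = v j.
Proof.
move=> vb um uv vm; have [bm|bm] := eqVneq b m.
  by rewrite -bm pivot_correction_row_b // uv.
by rewrite !mxE um vm //; field.
Qed.

(** Every term of the correction at [(i, j)] has a factor [v i] or [v j], so one index is at most b,
    while the other lies in D and is at most m. Hence [(i, j)] or its transpose is dominated by the
    cell [(m, b)] of F. *)
Lemma pivot_correction_support (K : fieldType) n (F : {set 'I_n * 'I_n})
    (D : {set 'I_n}) (m b : 'I_n) (u v : 'I_n -> K) i j :
  is_ferrers F -> is_symmetric F -> (m, b) \in F ->
  (forall d, d \in D -> (d <= m)%N) ->
  (forall k, u k != 0 -> k \in D) ->
  (forall k, v k != 0 -> (k \in D) && (k <= b)%N) ->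
  pivot_correction u v b i j != 0 -> (i, j) \in F :&: setX D D.
Proof.
move=> ferF symF mbF maxm uD vD.
have inF k l : k \in D -> l \in D -> (l <= b)%N -> (k, l) \in F :&: setX D D.
  move=> kD lD lb; rewrite !inE kD lD !andbT.
  by apply: ferF mbF _ _ (maxm _ kD) lb.
rewrite mxE; have [vi0|vi] := eqVneq (v i) 0.
  rewrite vi0 !(mulr0, mul0r) addr0 subr0 !mulf_eq0 !negb_or.
  by move=> /andP[/andP[/uD iD /vD /andP[jD jb]] _]; apply: inF.
have /andP[iD ib] := vD _ vi.
have [vj0|vj] := eqVneq (v j) 0.
  rewrite vj0 !(mulr0, mul0r) add0r subr0 !mulf_eq0 !negb_or.
  move=> /andP[/andP[_ /uD jD] _].
  have := inF _ _ jD iD ib; rewrite !inE /= => /andP[/symF -> _].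
  by rewrite iD jD.
by move=> _; have /andP[jD jb] := vD _ vj; apply: inF.
Qed.

(* Free parameters for rows m and b: the entry of row b at m, fixed by symmetry,
   and all of row b when b = m, are replaced by 0 so as not to be counted twice. *)
Definition pivot_rows (K : finFieldType) n (m b : 'I_n) (A : 'M[K]_n) :
    {ffun 'I_n -> K} * {ffun 'I_n -> K} :=
  ([ffun j => A m j],
   [ffun j => if (b == m) || (j == m) then 0 else A b j]).

(** Decodes row b from the free parameters, restoring the entries that [pivot_rows] blanks. *)
Definition pivot_row_b (K : finFieldType) n (m b : 'I_n)
    (p : {ffun 'I_n -> K} * {ffun 'I_n -> K}) (j : 'I_n) : K :=
  if b == m then p.1 j else if j == m then p.1 b else p.2 j.

Lemma pivot_row_b_rows (K : finFieldType) n (m b : 'I_n) (A : 'M[K]_n) :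
  (forall i j, A i j = A j i) -> pivot_row_b m b (pivot_rows m b A) =1 A b.
Proof.
move=> symA j; rewrite /pivot_row_b /pivot_rows /= !ffunE.
by case: eqVneq => [-> //|_]; case: eqVneq => [-> //|//].
Qed.

Lemma pivot_correction_eq (K : fieldType) n (u v u' v' : 'I_n -> K) b :
  u =1 u' -> v =1 v' -> pivot_correction u v b = pivot_correction u' v' b.
Proof. by move=> uu vv; apply/matrixP => i j; rewrite !mxE !uu !vv. Qed.

(** A matrix amounts to the free entries of rows m and b together with its remainder on [D']. Its
    rank depends on the remainder alone, so the sum factors and the free entries contribute only
    their number. *)
Lemma sum_last_pivot (R : comNzRingType) (K : finFieldType) n
    (F : {set 'I_n * 'I_n}) (D : {set 'I_n}) (m b : 'I_n) (f : nat -> R) :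
  is_ferrers F -> is_symmetric F -> (m, b) \in F :&: setX D D ->
  (forall d, d \in D -> (d <= m)%N) ->
  let D' := D :\: [set m; b] in
  \sum_(A in SymMx K (F :&: setX D D) | last_pivot A m b) f (\rank A) =
  pivot_count #|K|%:R D m b *
  \sum_(A in SymMx K (F :&: setX D' D')) f (#|[set m; b]| + \rank A)%N.
Proof.
move=> ferF symF + maxm D'; rewrite !inE => /and3P[/= mbF mD bD].
pose C (p : {ffun 'I_n -> K} * {ffun 'I_n -> K}) :=
  pivot_correction (pivot_row_b m b p) p.1 b.
(* [h] rebuilds a matrix from parameters and remainder; [h'] decomposes it. *)
pose h (x : ({ffun 'I_n -> K} * {ffun 'I_n -> K}) * 'M[K]_n) : 'M[K]_n :=
  x.2 + C x.1.
pose h' (A : 'M[K]_n) : ({ffun 'I_n -> K} * {ffun 'I_n -> K}) * 'M[K]_n :=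
  (pivot_rows m b A, A - C (pivot_rows m b A)).
pose S := [pred p : {ffun 'I_n -> K} * {ffun 'I_n -> K} |
    (p.1 \in family (@pivot_row_family K n D b)) &&
    (p.2 \in family (@free_row_family K n D m b))].
have hK (A : 'M[K]_n) : h (h' A) = A by rewrite /h /h' /= subrK.
have CE (A : 'M[K]_n) : (forall i j, A i j = A j i) ->
    C (pivot_rows m b A) = pivot_correction (A b) (A m) b.
  move=> symA; apply: pivot_correction_eq; first exact: pivot_row_b_rows.
  by move=> j; rewrite /= ffunE.
have bm_le : (b <= m)%N by apply: maxm.
have last0 (A : 'M[K]_n) (j : 'I_n) : last_pivot A m b -> (b < j)%N -> A m j = 0.
  by move=> /andP[_ /forallP/(_ j)/implyP H] /H/eqP.
have ltbm : b != m -> (b < m)%N.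
  by move=> bm; rewrite ltn_neqAle bm.
have forward (A : 'M[K]_n) : A \in SymMx K (F :&: setX D D) -> last_pivot A m b ->
    [/\ \rank A = (#|[set m; b]| + \rank (h' A).2)%N, (h' A).1 \in S
      & (h' A).2 \in SymMx K (F :&: setX D' D')].
  move=> /SymMxP[symA suppA] lastA.
  have Amb : A m b != 0 by case/andP: lastA.
  have rowD i j : A i j != 0 -> j \in D.
    by move=> /suppA; rewrite !inE => /and3P[].
  have Am0 : b != m -> A m m = 0 by move=> /ltbm; apply: last0.
  rewrite /h' /= CE //; split; first exact: rank_pivot_correction.
    rewrite inE; apply/andP; split; apply/familyP => j; rewrite !inE ffunE.
      case: eqVneq => [-> //|jb].
      rewrite orbC; have [//|/= Amj] := eqVneq (A m j) 0.
      rewrite (rowD _ _ Amj) /= ltn_neqAle jb leqNgt.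
      by apply: contraNN Amj => bj; rewrite (last0 _ _ lastA bj).
    case: (b == m); first by rewrite eqxx.
    case: eqVneq => [->|_] /=; first by rewrite eqxx.
    by rewrite orbC; have [//|/= /rowD] := eqVneq (A b j) 0.
  have rowm j : pivot_correction (A b) (A m) b m j = A m j.
    by apply: pivot_correction_row_m => // ->.
  have rowb j : pivot_correction (A b) (A m) b b j = A b j.
    exact: pivot_correction_row_b.
  set C0 := pivot_correction _ _ _ in rowm rowb *.
  have BE i j : (A - C0) i j = A i j - C0 i j by rewrite mxE [(- C0 : matrix _ _ _) i j]mxE.
  have symB i j : (A - C0) i j = (A - C0) j i.
    by rewrite !BE symA /C0 pivot_correction_sym.
  have suppB i j : (A - C0) i j != 0 -> i \notin [set m; b].
    apply: contraNN; rewrite !inE BE.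
    by case/orP=> /eqP->; rewrite ?rowm ?rowb subrr.
  apply/SymMxP; split=> // i j Bij.
  (* Rows m and b of the remainder vanish, and so do the columns by symmetry; only membership in the
     larger board is left. *)
  suff : (i, j) \in F :&: setX D D.
    have iN := suppB _ _ Bij; have jN : j \notin [set m; b].
      by apply: (suppB j i); rewrite symB.
    rewrite /D' in_setI in_setX /= => /and3P[ijF iD jD].
    by rewrite in_setI in_setX /= ijF !in_setD iN jN iD jD.
  have [Cij|Cij] := eqVneq (C0 i j) 0.
    by apply: suppA; move: Bij; rewrite BE Cij subr0.
  apply: pivot_correction_support mbF maxm _ _ Cij => // k.
    exact: rowD.
  move=> Amk; rewrite (rowD _ _ Amk) leqNgt.
  by apply: contraNN Amk => bk; rewrite (last0 _ _ lastA bk).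
have backward x : x.1 \in S -> x.2 \in SymMx K (F :&: setX D' D') ->
    (h x \in SymMx K (F :&: setX D D)) && last_pivot (h x) m b &&
    (h' (h x) == x).
  case: x => -[v w] B /andP[/familyP /= vS /familyP /= wS] /SymMxP[/= symB suppB].
  set u := pivot_row_b m b (v, w).
  have vb : v b != 0 by have := vS b; rewrite !inE eqxx.
  have um : u m = v b by rewrite /u /pivot_row_b eqxx /=; case: eqVneq => [->|].
  have vD j : v j != 0 -> (j \in D) && (j <= b)%N.
    move=> vj; have := vS j; rewrite !inE (negPf vj).
    case: eqVneq => [->|_]; first by rewrite bD leqnn.
    by rewrite orbF => /andP[-> /ltnW].
  have uD j : u j != 0 -> j \in D.
    rewrite /u /pivot_row_b /=; case: (eqVneq b m) => [_ /vD/andP[]//|bm].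
    case: (eqVneq j m) => [-> //|jm] wj.
    by have := wS j; rewrite !inE bm jm (negPf wj) orbF.
  have uv : b = m -> u =1 v by move=> bm j; rewrite /u /pivot_row_b bm eqxx.
  have vm : b != m -> v m = 0.
    move=> /ltbm bm; apply/eqP; apply: contraTT bm => /vD/andP[_].
    by rewrite leqNgt.
  have B0 i j : i \in [set m; b] -> B i j = 0.
    move=> imb; apply/eqP; apply: contraTT imb => /suppB.
    by rewrite !inE /= => /and3P[_ /andP[-> _] _].
  have hE i j : h (v, w, B) i j = B i j + pivot_correction u v b i j.
    by rewrite mxE.
  have rowm j : h (v, w, B) m j = v j.
    by rewrite hE B0 ?inE ?eqxx // add0r; apply: pivot_correction_row_m.
  have rowb j : h (v, w, B) b j = u j.
    by rewrite hE B0 ?inE ?eqxx ?orbT // add0r; apply: pivot_correction_row_b.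
  have rows : pivot_rows m b (h (v, w, B)) = (v, w).
    congr pair; apply/ffunP => j; rewrite ffunE ?rowm // rowb /u /pivot_row_b /=.
    have := wS j; rewrite !inE.
    case: (eqVneq b m) => [_ /eqP->//|bm] /=.
    by case: (eqVneq j m) => [_ /eqP->//|//].
  apply/andP; split; last by rewrite /h' rows /h /= addrK.
  apply/andP; split; last first.
    rewrite /last_pivot rowm vb; apply/forallP => j; apply/implyP => bj.
    by rewrite rowm; apply: contraTT bj => /vD/andP[_]; rewrite -leqNgt.
  apply/SymMxP; split=> i j; rewrite !hE.
    by rewrite symB pivot_correction_sym.
  have [Bij|/suppB] := eqVneq (B i j) 0; last first.
    by rewrite !inE /= => /and3P[-> /andP[_ ->] /andP[_ ->]].
  rewrite Bij add0r; exact: (pivot_correction_support ferF symF mbF maxm uD vD).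
(* The left side is the condition produced by [reindex_onto]; in product form it lets parameters and
   remainder be summed independently. *)
have inS x : (h x \in SymMx K (F :&: setX D D)) && last_pivot (h x) m b &&
    (h' (h x) == x) = (x.1 \in S) && (x.2 \in SymMx K (F :&: setX D' D')).
  apply/idP/andP => [/andP[/andP[hS hl] /eqP<-]|[]]; last exact: backward.
  by have [_ -> ->] := forward _ hS hl.
rewrite (reindex_onto h h'); last by move=> A _; apply: hK.
rewrite (eq_bigl _ _ inS) (eq_bigr (fun x => f (#|[set m; b]| + \rank x.2)%N)).
  rewrite -(pair_big_dep (fun p => p \in S)
    (fun _ B => B \in SymMx K (F :&: setX D' D'))
    (fun _ B => f (#|[set m; b]| + \rank B)%N)) /=.
  rewrite sumr_const -[LHS]mulr_natl; congr (_ * _).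
  rewrite (eq_card (B := [predX family (@pivot_row_family K n D b)
      & family (@free_row_family K n D m b)])); last by case.
  rewrite cardX card_pivot_rows card_free_rows /pivot_count !natrM natrX.
  rewrite -subn1 natrB; last exact: ltnW (card_finRing_gt1 K).
  by case: (b == m); rewrite ?natrX.
move=> x; rewrite -inS => /andP[/andP[hS hl] /eqP hx].
by have [-> _ _] := forward _ hS hl; rewrite hx.
Qed.

Lemma sum_SymMx_last_pivot (R : comNzRingType) (K : finFieldType) n
    (F : {set 'I_n * 'I_n}) (D : {set 'I_n}) (m : 'I_n) (f : nat -> R) :
  is_ferrers F -> is_symmetric F -> m \in D ->
  (forall d, d \in D -> (d <= m)%N) ->
  \sum_(A in SymMx K (F :&: setX D D)) f (\rank A) =
  \sum_(A in SymMx K (F :&: setX (D :\ m) (D :\ m))) f (\rank A) +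
  \sum_(b | (m, b) \in F :&: setX D D) pivot_count #|K|%:R D m b *
    \sum_(A in SymMx K (F :&: setX (D :\: [set m; b]) (D :\: [set m; b])))
      f (#|[set m; b]| + \rank A)%N.
Proof.
move=> ferF symF mD maxm.
rewrite (@sum_unique_witness _ _ _ _ (fun A b => last_pivot A m b)); last first.
  move=> A j k _ /andP[Aj /forallP lj] /andP[Ak /forallP lk].
  apply/val_inj/eqP; rewrite eqn_leq (leqNgt j) (leqNgt k); apply/andP; split.
    by apply: contraNN Aj; apply/implyP.
  by apply: contraNN Ak; apply/implyP.
congr (_ + _).
  apply: eq_bigl => A; apply/andP/SymMxP.
    move=> [/SymMxP[symA suppA] /forallP noA].
    have Am0 j : A m j = 0.
      apply/eqP/negPn/negP => Amj.
      (* The largest column with a nonzero entry in row m would be a last pivot. *)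
      have [b Amb maxb] := arg_maxnP (P := fun j => A m j != 0) val Amj.
      have := noA b; rewrite /last_pivot Amb /= => /forallPn[k].
      by rewrite negb_imply ltnNge => /andP[bk /maxb]; rewrite /= (negPf bk).
    split=> // i j Aij; have := suppA _ _ Aij.
    rewrite !inE /= => /and3P[-> -> ->]; rewrite !andbT /=.
    apply/andP; split; apply: contraNneq Aij => ->; first by rewrite Am0.
    by rewrite symA Am0.
  move=> [symA suppA]; split.
    apply/SymMxP; split=> // i j /suppA.
    by rewrite !inE /= => /and3P[-> /andP[_ ->] /andP[_ ->]].
  apply/forallP => j; rewrite /last_pivot negb_and negbK orbC.
  by case: (eqVneq (A m j) 0) => [|/suppA]; rewrite ?orbT // !inE eqxx andbF.
rewrite (bigID (fun b => (m, b) \in F :&: setX D D)) /= [X in _ + X]big1 ?addr0.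
  by apply: eq_bigr => b mbF; apply: sum_last_pivot.
move=> b mbF; apply: big1 => A /andP[/SymMxP[_ suppA] /andP[/suppA]].
by rewrite (negPf mbF).
Qed.

(** * Symmetric rook placements and the cells they attack *)

(** Closure under transposition turns uniqueness within rows into uniqueness within columns, so the
    row condition alone expresses non-attack. *)
Lemma sym_placementsP n (F : {set 'I_n * 'I_n}) (D : {set 'I_n})
    (P : {set 'I_n * 'I_n}) :
  reflect [/\ forall i j, (i, j) \in P -> [&& (i, j) \in F, i \in D & j \in D],
              forall i j k, (i, j) \in P -> (i, k) \in P -> j = k
            & forall i j, (i, j) \in P -> (j, i) \in P]
          (P \in sym_placements F D).
Proof.
rewrite inE; apply: (iffP and3P) => [[/subsetP subP naP symP]|[subP funP symP]].
  split=> [i j /subP|i j k ijP ikP|i j ijP]; first by rewrite !inE.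
    apply/eqP; have /forall_inP/(_ _ ijP)/forall_inP/(_ _ ikP) := naP.
    by rewrite xpair_eqE eqxx /=; case: (j == k).
  exact: (forall_inP symP _ ijP).
split; first by apply/subsetP => -[i j] /subP; rewrite !inE.
  apply/forall_inP => -[i j] ijP; apply/forall_inP => -[k l] klP.
  apply/implyP; apply: contraNT; rewrite negb_and !negbK /= => /orP[]/eqP e.
    by subst k; rewrite (funP _ _ _ ijP klP).
  by subst l; rewrite (funP _ _ _ (symP _ _ ijP) (symP _ _ klP)).
by apply/forall_inP => -[i j] /symP.
Qed.

Lemma mem_ATK n (P : {set 'I_n * 'I_n}) (i j : 'I_n) :
  reflect (exists k l, (k, l) \in P /\
             ((i <= k)%N && (j == l) || (i == k) && (j <= l)%N))
          ((i, j) \in ATK P).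
Proof.
apply: (iffP bigcupP) => [[[k l] klP]|[k [l [klP ijkl]]]].
  rewrite inE => /orP[]/imsetP[s /=]; rewrite inE => le [-> ->];
    by exists k, l; split=> //; rewrite le eqxx ?orbT.
exists (k, l) => //; rewrite inE; apply/orP.
case/orP: ijkl => /andP[]; [move=> ik /eqP-> | move=> /eqP-> jl].
  by left; apply/imsetP; exists i; rewrite ?inE.
by right; apply/imsetP; exists j; rewrite ?inE.
Qed.

(** For a symmetric placement this is the number of orbits under transposition, each represented on
    or above the diagonal. *)
Definition orbit_count n (P : {set 'I_n * 'I_n}) : nat :=
  #|[set c in P | (c.1 <= c.2)%N]|.

(* With t + s = orbit_count P and x = sqrt q this is the term of the theorem,
   (q - 1)^(t+s) q^((|F| - t - s - inv(F, P)) / 2), when D is everything. *)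
Definition placement_weight (R : fieldType) (x : R) n (D : {set 'I_n})
    (P : {set 'I_n * 'I_n}) : R :=
  ((x ^+ 2 - 1) / x) ^+ orbit_count P * x ^+ #|ATK P :&: setX D D|.

Definition rook_pair n (m b : 'I_n) : {set 'I_n * 'I_n} := [set (m, b); (b, m)].

(** The number of rooks added thus equals the number of rank-reduction steps, also when [b = m] and
    the pair is a single rook. *)
Lemma card_rook_pair n (m b : 'I_n) : #|rook_pair m b| = #|[set m; b]|.
Proof. by rewrite !cards2 xpair_eqE (eq_sym b m) andbb. Qed.

(* The cells of D x D that the rooks (m, b) and (b, m) attack, m = max D. *)
Definition cross n (D : {set 'I_n}) (m b : 'I_n) : {set 'I_n * 'I_n} :=
  [set c in setX D D | [|| c.1 == b, c.2 == b, (c.1 == m) && (c.2 < b)%N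
                         | (c.2 == m) && (c.1 < b)%N]].

(** Row and column b of D x D belong to the cross and share one cell; for [b < m], row and column m
    add their parts before b. For [b = m] the set [below D b] is [D :\ m]. *)
Lemma card_cross n (D : {set 'I_n}) (m b : 'I_n) :
  m \in D -> b \in D -> (forall d, d \in D -> (d <= m)%N) ->
  #|cross D m b| =
  (1 + 2 * #|below D b| + (if b == m then 0 else 2 * #|D :\ m|))%N.
Proof.
move=> mD bD maxm.
have cardD d : d \in D -> #|D| = #|D :\ d|.+1 by move=> dD; rewrite (cardsD1 d) dD.
(* Removing any single element from D leaves the same number, so row b may be measured by
   [D :\ m]. *)
have cardDm : #|D :\ b| = #|D :\ m|.
  by apply: succn_inj; rewrite -!cardD.
have -> : cross D m b = (setX [set b] D :|: setX (D :\ b) [set b]) :|: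
    (if b == m then set0 else
     setX [set m] (below D b) :|: setX (below D b) [set m]).
  apply/setP => -[i j]; rewrite !inE /=; case: (eqVneq b m) => [bm|bm].
    subst b; rewrite !inE /=.
    case: (eqVneq i m) => [->|_]; case: (eqVneq j m) => [->|_] //=;
      by rewrite ?mD ?orbF ?andbT ?andbF.
  rewrite !inE /=.
  case: (eqVneq i b) => [->|ib]; case: (eqVneq j b) => [->|jb] //=;
    rewrite ?bD ?ltnn ?(negPf bm) ?andbT ?andbF ?orbF ?orbT //=.
  case: (eqVneq i m) => [->|im]; case: (eqVneq j m) => [->|jm] //=;
    by rewrite ?mD ?andbT ?andbF ?orbF ?orbT //= ?orbb ?(andbC (_ \in D)).
have [bm|bm] := eqVneq b m.
  subst b; rewrite setU0 addn0 cardsU.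
  rewrite (_ : _ :&: _ = set0) ?cards0 ?subn0.
    rewrite !cardsX !cards1 mul1n muln1 (cardD m mD).
    rewrite (_ : D :\ m = below D m); first by rewrite mul2n -addnn.
    apply/setP => j; rewrite !inE andbC; case jD: (j \in D) => //=.
    by rewrite ltn_neqAle (maxm _ jD) andbT.
  apply/setP => -[i j]; rewrite !inE /=.
  by case: (eqVneq i m); rewrite ?andbF.
have ltbm : (b < m)%N by rewrite ltn_neqAle bm maxm.
rewrite cardsU (_ : _ :&: _ = set0) ?cards0 ?subn0; last first.
  apply/setP => -[i j]; rewrite !inE /=.
  case: (eqVneq i b) => [->|ib]; case: (eqVneq j b) => [->|jb] //=;
    by rewrite ?(ltnn, negPf bm, andbF, orbF).
rewrite cardsU (_ : _ :&: _ = set0) ?cards0 ?subn0; last first.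
  by apply/setP => -[i j]; rewrite !inE /=; case: (eqVneq i b); rewrite ?andbF.
rewrite cardsU (_ : _ :&: _ = set0) ?cards0 ?subn0; last first.
  apply/setP => -[i j]; rewrite !inE /=; case: (eqVneq i m) => [->|//].
  by rewrite (ltnNge m b) (ltnW ltbm) ?(andbF, andFb).
rewrite !cardsX !cards1 !mul1n !muln1 (cardD b bD) cardDm.
by rewrite !mul2n -!addnn; ring.
Qed.

Lemma mem_setD2 n (D : {set 'I_n}) (m b k : 'I_n) :
  (k \in D :\: [set m; b]) = [&& k != m, k != b & k \in D].
Proof. by rewrite !inE negb_or andbA. Qed.

Lemma mem_board n (F : {set 'I_n * 'I_n}) (D : {set 'I_n}) (i j : 'I_n) :
  ((i, j) \in F :&: setX D D) = [&& (i, j) \in F, i \in D & j \in D].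
Proof. by rewrite !inE. Qed.

Lemma mem_cross n (D : {set 'I_n}) (m b i j : 'I_n) :
  ((i, j) \in cross D m b) = [&& i \in D, j \in D &
    [|| i == b, j == b, (i == m) && (j < b)%N | (j == m) && (i < b)%N]].
Proof. by rewrite !inE /= andbA. Qed.

Lemma rook_pair_sym n (m b i j : 'I_n) :
  ((i, j) \in rook_pair m b) = ((j, i) \in rook_pair m b).
Proof. by rewrite !inE !xpair_eqE orbC ![_ && (j == _)]andbC. Qed.

Lemma rook_pair_fun n (m b i j k : 'I_n) :
  (i, j) \in rook_pair m b -> (i, k) \in rook_pair m b -> j = k.
Proof.
rewrite !inE !xpair_eqE => /orP[]/andP[/eqP-> /eqP->];
  by case/orP=> /andP[/eqP e /eqP->].
Qed.

Lemma mem_rook_pairP n (m b i j : 'I_n) :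
  reflect (i = m /\ j = b \/ i = b /\ j = m) ((i, j) \in rook_pair m b).
Proof.
rewrite !inE !xpair_eqE.
apply: (iffP orP) => -[].
- by move=> /andP[/eqP-> /eqP->]; left.
- by move=> /andP[/eqP-> /eqP->]; right.
- by move=> [-> ->]; left; rewrite !eqxx.
by move=> [-> ->]; right; rewrite !eqxx.
Qed.

(** Rows m and b are taken by the pair, and by symmetry so are the columns; all other rooks avoid
    both indices. *)
Lemma remove_rook_pair n (F : {set 'I_n * 'I_n}) (D : {set 'I_n}) (m b : 'I_n)
    (P : {set 'I_n * 'I_n}) :
  P \in sym_placements F D -> (m, b) \in P ->
  [/\ rook_pair m b \subset P
    & P :\: rook_pair m b \in sym_placements F (D :\: [set m; b])].
Proof.
move=> /sym_placementsP[subP funP symP] mbP; have bmP := symP _ _ mbP.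
have avoid i j : (i, j) \in P -> (i, j) \notin rook_pair m b ->
    (i != m) && (i != b).
  move=> ijP; apply: contraNT; rewrite negb_and !negbK => /orP[]/eqP e; subst i.
    by rewrite (funP _ _ _ ijP mbP) !inE eqxx.
  by rewrite (funP _ _ _ ijP bmP) !inE eqxx orbT.
split; first by apply/subsetP => c; rewrite !inE => /orP[]/eqP->.
apply/sym_placementsP; split=> [i j|i j k|i j]; rewrite !in_setD.
- move=> /andP[N ijP]; have /and3P[-> iD jD] := subP _ _ ijP.
  have /andP[im ib] := avoid _ _ ijP N.
  rewrite rook_pair_sym in N; have /andP[jm jb] := avoid _ _ (symP _ _ ijP) N.
  by rewrite !in_set2 !negb_or im ib jm jb iD jD.
- by move=> /andP[_ ijP] /andP[_ ikP]; apply: funP ijP ikP.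
by rewrite rook_pair_sym => /andP[-> /symP].
Qed.

Lemma add_rook_pair n (F : {set 'I_n * 'I_n}) (D : {set 'I_n}) (m b : 'I_n)
    (P : {set 'I_n * 'I_n}) :
  is_symmetric F -> (m, b) \in F :&: setX D D ->
  P \in sym_placements F (D :\: [set m; b]) ->
  [/\ P :|: rook_pair m b \in sym_placements F D
    & [disjoint P & rook_pair m b]].
Proof.
move=> symF + /sym_placementsP[subP funP symP].
rewrite mem_board => /and3P[mbF mD bD].
have avoid i j : (i, j) \in P -> [&& i != m, i != b & i \in D].
  by move=> /subP/and3P[_ + _]; rewrite mem_setD2.
have not_pair i j k : (i, j) \in P -> (i, k) \notin rook_pair m b.
  move=> /avoid/and3P[im ib _]; apply/mem_rook_pairP => -[] [e _].
    by rewrite e eqxx in im.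
  by rewrite e eqxx in ib.
split; last first.
  by rewrite disjoint_subset; apply/subsetP => -[i j] /not_pair; apply.
have memU i j : ((i, j) \in P :|: rook_pair m b) =
    ((i, j) \in P) || ((i, j) \in rook_pair m b) by rewrite in_setU.
apply/sym_placementsP; split=> [i j|i j k|i j]; rewrite !memU.
- case/orP=> [ijP|].
    have /and3P[-> _ _] := subP _ _ ijP.
    have /and3P[_ _ ->] := avoid _ _ ijP.
    by have /and3P[_ _ ->] := avoid _ _ (symP _ _ ijP).
  by case/mem_rook_pairP=> -[-> ->]; rewrite ?mbF ?(symF _ _ mbF) mD bD.
- case/orP=> [ijP|ijR]; case/orP=> [ikP|ikR].
  + exact: funP ijP ikP.
  + by rewrite (negPf (not_pair _ _ _ ijP)) in ikR.
  + by rewrite (negPf (not_pair _ _ _ ikP)) in ijR.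
  exact: rook_pair_fun ijR ikR.
by case/orP=> [/symP ->//|]; rewrite rook_pair_sym => ->; rewrite orbT.
Qed.

(** Attacks run only towards smaller indices. The rooks of [P] have both indices below m, so they
    reach no cell of row or column m, and what they attack in row or column b is already in the
    cross. *)
Lemma ATK_add_rook_pair n (F : {set 'I_n * 'I_n}) (D : {set 'I_n})
    (m b : 'I_n) (P : {set 'I_n * 'I_n}) :
  m \in D -> b \in D -> (forall d, d \in D -> (d <= m)%N) ->
  let D' := D :\: [set m; b] in
  P \in sym_placements F D' ->
  ATK (P :|: rook_pair m b) :&: setX D D =
  (ATK P :&: setX D' D') :|: cross D m b.
Proof.
move=> mD bD maxm D' /sym_placementsP[subP _ symP].
have rowP k l : (k, l) \in P -> [&& k != m, k != b & k \in D].
  by move=> /subP/and3P[_ + _]; rewrite mem_setD2.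
apply/setP => -[i j]; rewrite !in_setU in_setI in_setX /= in_setI in_setX /=.
rewrite mem_cross !mem_setD2.
case iD: (i \in D); last by rewrite !andbF.
case jD: (j \in D); last by rewrite !andbF.
rewrite !andbT /=.
have [crs|ncrs] := boolP [|| i == b, j == b, _ | _].
  have mbU : (m, b) \in P :|: rook_pair m b by rewrite !inE eqxx ?orbT.
  have bmU : (b, m) \in P :|: rook_pair m b by rewrite !inE eqxx ?orbT.
  rewrite orbT; apply/mem_ATK; case/or4P: crs => [/eqP->|/eqP->|/andP[]|/andP[]].
  - by exists b, m; rewrite eqxx (maxm _ jD) orbT.
  - by exists m, b; rewrite eqxx (maxm _ iD).
  - by move=> /eqP-> /ltnW jb; exists m, b; rewrite eqxx jb orbT.
  by move=> /eqP-> /ltnW ib; exists b, m; rewrite eqxx ib.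
move: ncrs; rewrite !negb_or !negb_and -!leqNgt => /and4P[ib jb im jm].
rewrite orbF ib jb !andbT; apply/mem_ATK/idP.
  move=> [k [l []]]; rewrite in_setU => /orP[klP atk|/mem_rook_pairP].
    have /and3P[km kb kD] := rowP _ _ klP.
    have /and3P[lm lb lD] := rowP _ _ (symP _ _ klP).
    apply/and3P; split; first by apply/mem_ATK; exists k, l.
      apply: contraTneq atk => ->; rewrite (eq_sym m) (negPf km) orbF negb_and.
      by rewrite -ltnNge ltn_neqAle km (maxm _ kD).
    apply: contraTneq atk => ->; rewrite (eq_sym m) (negPf lm) andbF /= negb_and.
    by rewrite -ltnNge ltn_neqAle lm (maxm _ lD) orbT.
  case=> -[-> ->]; rewrite ?(negPf ib, negPf jb, andbF, orbF) /=.
    move=> /andP[imE jle]; move: im; rewrite imE /= => bj.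
    by case/eqP: jb; apply/val_inj/eqP; rewrite eqn_leq jle bj.
  move=> /andP[ile jmE]; move: jm; rewrite jmE /= => bi.
  by case/eqP: ib; apply/val_inj/eqP; rewrite eqn_leq ile bi.
by move=> /and3P[/mem_ATK[k [l [klP atk]]] _ _]; exists k, l; rewrite in_setU klP.
Qed.

(** * Placement weights and their recursion *)

(** The pair forms one orbit, represented by [(b, m)] since [b <= m]. *)
Lemma orbit_count_add_rook_pair n (m b : 'I_n) (P : {set 'I_n * 'I_n}) :
  (b <= m)%N -> [disjoint P & rook_pair m b] ->
  orbit_count (P :|: rook_pair m b) = (orbit_count P).+1.
Proof.
move=> bm disj; rewrite /orbit_count.
have -> : [set c in P :|: rook_pair m b | (c.1 <= c.2)%N] =
          (b, m) |: [set c in P | (c.1 <= c.2)%N].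
  apply/setP => -[i j]; rewrite !inE /= andb_orl orbC; congr (_ || _).
  rewrite !xpair_eqE; apply/andP/idP => [[/orP[]/andP[/eqP-> /eqP->]]|/andP[]].
  - by move=> mb; rewrite -!val_eqE /= !eqn_leq mb bm.
  - by rewrite !eqxx.
  by move=> /eqP-> /eqP->; rewrite !eqxx bm orbT.
rewrite cardsU1 in_set /= bm andbT.
by rewrite (disjointFl disj) // !inE eqxx orbT.
Qed.

(** The new orbit gives [(x ^+ 2 - 1) / x] and the disjoint cross gives x to an odd power by
    [card_cross]; the division by x absorbs the odd 1, leaving powers of [x ^+ 2]. *)
Lemma placement_weight_add_rook_pair (R : fieldType) (x : R) n
    (F : {set 'I_n * 'I_n}) (D : {set 'I_n}) (m b : 'I_n)
    (P : {set 'I_n * 'I_n}) :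
  x != 0 -> is_symmetric F -> (m, b) \in F :&: setX D D ->
  (forall d, d \in D -> (d <= m)%N) ->
  let D' := D :\: [set m; b] in
  P \in sym_placements F D' ->
  placement_weight x D (P :|: rook_pair m b) =
  pivot_count (x ^+ 2) D m b * placement_weight x D' P.
Proof.
move=> x0 symF mbF maxm D' PD'.
have [_ disj] := add_rook_pair symF mbF PD'.
move: mbF; rewrite mem_board => /and3P[mbF mD bD].
rewrite /placement_weight orbit_count_add_rook_pair ?maxm //.
rewrite (ATK_add_rook_pair mD bD maxm PD') cardsU [_ :&: cross _ _ _](_ : _ = set0).
  rewrite cards0 subn0 card_cross // /pivot_count.
  have sqX k : (x ^+ 2) ^+ k = x ^+ k * x ^+ k by rewrite exprAC expr2.
  rewrite !mul2n -!addnn exprS !exprD expr1 !sqX.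
  by case: (b == m); rewrite ?exprD; field.
apply/setP => -[i j]; rewrite in_set0 in_setI in_setI in_setX /= !mem_setD2.
rewrite mem_cross.
by case: (eqVneq i m); case: (eqVneq i b); case: (eqVneq j m); case: (eqVneq j b);
  rewrite ?andbF.
Qed.

Lemma sum_placements_rook (R : fieldType) (x : R) n
    (F : {set 'I_n * 'I_n}) (D : {set 'I_n}) (m b : 'I_n) (f : nat -> R) :
  x != 0 -> is_symmetric F -> (m, b) \in F :&: setX D D ->
  (forall d, d \in D -> (d <= m)%N) ->
  let D' := D :\: [set m; b] in
  \sum_(P in sym_placements F D | (m, b) \in P) placement_weight x D P * f #|P| =
  pivot_count (x ^+ 2) D m b *
  \sum_(P in sym_placements F D')
    placement_weight x D' P * f (#|[set m; b]| + #|P|)%N.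
Proof.
move=> x0 symF mbF maxm D'.
rewrite (reindex_onto (fun P => P :|: rook_pair m b)
  (fun P => P :\: rook_pair m b)) /=; last first.
  move=> P /andP[PD mbP]; have [sub _] := remove_rook_pair PD mbP.
  by rewrite setUC -{1}(setIidPr sub) setID.
rewrite big_distrr /=; apply: eq_big => P.
  apply/idP/idP => [/andP[/andP[PD mbP] /eqP<-]|PD].
    by have [_ ->] := remove_rook_pair PD mbP.
  have [-> disj] := add_rook_pair symF mbF PD.
  rewrite setDUl setDv setU0 !inE eqxx orbT /=.
  by apply/eqP/setDidPl.
move=> /andP[/andP[PD mbP] /eqP PE].
have [_] := remove_rook_pair PD mbP; rewrite PE => PD'.
have [_ disj] := add_rook_pair symF mbF PD'.
rewrite (placement_weight_add_rook_pair x0 symF mbF maxm PD') -mulrA.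
by rewrite cardsU (disjoint_setI0 disj) cards0 subn0 card_rook_pair addnC.
Qed.

Lemma sum_placements_last_row (R : fieldType) (x : R) n
    (F : {set 'I_n * 'I_n}) (D : {set 'I_n}) (m : 'I_n) (f : nat -> R) :
  x != 0 -> is_symmetric F -> m \in D -> (forall d, d \in D -> (d <= m)%N) ->
  \sum_(P in sym_placements F D) placement_weight x D P * f #|P| =
  \sum_(P in sym_placements F (D :\ m)) placement_weight x (D :\ m) P * f #|P| +
  \sum_(b | (m, b) \in F :&: setX D D) pivot_count (x ^+ 2) D m b *
    \sum_(P in sym_placements F (D :\: [set m; b]))
      placement_weight x (D :\: [set m; b]) P * f (#|[set m; b]| + #|P|)%N.
Proof.
move=> x0 symF mD maxm.
rewrite (@sum_unique_witness _ _ _ _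
  (fun (P : {set 'I_n * 'I_n}) b => (m, b) \in P)); last first.
  by move=> P j k /sym_placementsP[_ funP _]; apply: funP.
congr (_ + _).
  have no_rook P : (P \in sym_placements F D) && [forall j, (m, j) \notin P] =
      (P \in sym_placements F (D :\ m)).
    apply/andP/sym_placementsP => [[/sym_placementsP[subP funP symP] /forallP noP]|].
      split=> // i j ijP; have /and3P[-> iD jD] := subP _ _ ijP.
      rewrite !in_setD1 iD jD !andbT /=; apply/andP; split.
        by apply: contraTneq ijP => ->.
      by apply: contraTneq (symP _ _ ijP) => ->.
    move=> [subP funP symP]; split.
      apply/sym_placementsP; split=> // i j /subP.
      by rewrite !in_setD1 => /and3P[-> /andP[_ ->] /andP[_ ->]].
    by apply/forallP => j; apply/negP => /subP; rewrite !in_setD1 eqxx andbF.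
  apply: eq_big => [//|P]; rewrite no_rook => /sym_placementsP[subP _ symP].
  (* Without a rook in row or column m no cell there is attacked, so the weight is the same on [D]
     and on [D :\ m]. *)
  congr (_ * _ ^+ #|pred_of_set _| * _); apply/setP => -[i j].
  rewrite !in_setI !in_setX /= !in_setD1.
  case iD: (i \in D); last by rewrite !andbF.
  case jD: (j \in D); last by rewrite !andbF.
  case: (boolP ((i, j) \in ATK P)) => //= /mem_ATK[k [l [klP atk]]].
  have /and3P[_] := subP _ _ klP; rewrite !in_setD1.
  move=> /andP[km kD] /andP[lm lD]; rewrite !andbT; apply/esym/andP; split.
    apply: contraTneq atk => ->; rewrite (eq_sym m) (negPf km) orbF negb_and.
    by rewrite -ltnNge ltn_neqAle km (maxm _ kD).
  apply: contraTneq atk => ->; rewrite (eq_sym m) (negPf lm) andbF /= negb_and.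
  by rewrite -ltnNge ltn_neqAle lm (maxm _ lD) orbT.
rewrite (bigID (fun b => (m, b) \in F :&: setX D D)) /= [X in _ + X]big1 ?addr0.
  by apply: eq_bigr => b mbF; apply: sum_placements_rook.
move=> b; rewrite mem_board => mbF; apply: big1 => P.
by move=> /andP[/sym_placementsP[subP _ _] /subP]; rewrite (negPf mbF).
Qed.

(** * Matrices and placements compared by induction on D *)

(** [f] is arbitrary so that the induction goes through: each step shifts its argument by the one or
    two ranks, or rooks, split off. *)
Lemma sum_rank_eq_sum_placements (R : fieldType) (x : R) (K : finFieldType) n
    (F : {set 'I_n * 'I_n}) (D : {set 'I_n}) (f : nat -> R) :
  x != 0 -> x ^+ 2 = #|K|%:R -> is_ferrers F -> is_symmetric F ->
  \sum_(A in SymMx K (F :&: setX D D)) f (\rank A) =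
  \sum_(P in sym_placements F D) placement_weight x D P * f #|P|.
Proof.
move=> x0 xK ferF symF.
have [k] := ubnP #|D|; elim: k => // k IHk in D f *; rewrite ltnS => leDk.
have [->|/set0Pn[d dD]] := eqVneq D set0.
  (* On the empty board only the zero matrix and the empty placement remain. *)
  rewrite (big_pred1 0) ?(big_pred1 set0).
  - have orb0 : orbit_count (set0 : {set 'I_n * 'I_n}) = 0%N.
      by apply: eq_card0 => c; rewrite !inE.
    have setX0 : setX set0 set0 = set0 :> {set 'I_n * 'I_n}.
      by apply/setP => c; rewrite !inE.
    rewrite /placement_weight orb0 setX0 setI0.
    by rewrite mxrank0 !cards0 !expr0 !mul1r.
  - move=> P; apply/sym_placementsP/eqP => [[subP _ _]|->].
      apply/setP => -[i j]; rewrite in_set0; apply/negP => /subP.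
      by rewrite in_set0 andbF.
    by split=> [i j|i j l|i j]; rewrite in_set0.
  move=> A; apply/SymMxP/eqP => [[_ suppA]|->].
    apply/matrixP => i j; rewrite mxE; apply/eqP/negPn/negP => /suppA.
    by rewrite mem_board in_set0 andbF.
  by split=> i j; rewrite !mxE ?eqxx.
have [m mD maxm] := arg_maxnP (P := mem D) (fun i : 'I_n => val i) dD.
have le_m i : i \in D -> (i <= m)%N by move=> iD; apply: maxm.
have small (b : 'I_n) : (#|D :\: [set m; b]| < k)%N.
  apply: leq_trans leDk; rewrite (cardsD1 m D) [_ \in _]mD ltnS.
  by apply/subset_leq_card/setDS; rewrite sub1set !inE eqxx.
rewrite (sum_SymMx_last_pivot K f ferF symF mD le_m).
rewrite (sum_placements_last_row f x0 symF mD le_m) -xK.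
(* Writing [[set m]] as [[set m; m]] brings [D :\ m] under the bound [small]. *)
congr (_ + _); first by apply: IHk; rewrite -(setUid [set m]).
by apply: eq_bigr => b _; rewrite (IHk _ (fun r => f (#|[set m; b]| + r)%N)) ?small.
Qed.

(** * Return to [NAR_sym] and the q-rook polynomials *)

Definition upper_count n (P : {set 'I_n * 'I_n}) : nat :=
  #|[set c in P | (c.1 < c.2)%N]|.

Lemma card_off_diagonal n (P : {set 'I_n * 'I_n}) :
  (forall i j, (i, j) \in P -> (j, i) \in P) ->
  #|P :\: diagonal n| = (2 * upper_count P)%N.
Proof.
move=> symP; set U := [set c in P | (c.1 < c.2)%N].
pose sw (c : 'I_n * 'I_n) := (c.2, c.1).
have swK : involutive sw by case.
have -> : P :\: diagonal n = U :|: sw @: U.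
  apply/setP => -[i j]; rewrite (can_imset_pre _ swK) !inE /=.
  have -> : ((j, i) \in P) = ((i, j) \in P) by apply/idP/idP; apply: symP.
  by rewrite -andb_orr andbC -neq_ltn.
rewrite cardsU (card_imset _ (can_inj swK)) [_ :&: _](_ : _ = set0).
  by rewrite cards0 subn0 mul2n -addnn.
apply/setP => -[i j]; rewrite (can_imset_pre _ swK) !inE /=.
by case: ltngtP; rewrite ?andbF.
Qed.

Lemma orbit_count_split n (P : {set 'I_n * 'I_n}) :
  orbit_count P = (upper_count P + #|P :&: diagonal n|)%N.
Proof.
rewrite /orbit_count (_ : [set c in P | _] =
  [set c in P | (c.1 < c.2)%N] :|: (P :&: diagonal n)); last first.
  by apply/setP => -[i j]; rewrite !inE -andb_orr leq_eqVlt orbC.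
rewrite cardsU [[set c in P | _] :&: _](_ : _ = set0) ?cards0 ?subn0 //.
apply/setP => -[i j]; rewrite !inE /=.
by case: eqVneq => [->|]; rewrite ?ltnn ?andbF.
Qed.

(** In a decomposition into [T] and [S], the set [T] must be the off-diagonal part of [P] and [S]
    its diagonal part. So [P] determines [t] and [s], and any symmetric placement occurs for exactly
    one pair. *)
Lemma mem_NAR_sym n (F P : {set 'I_n * 'I_n}) (t s : nat) :
  (P \in NAR_sym F t s) =
  [&& P \in sym_placements F setT, t == upper_count P & s == #|P :&: diagonal n|].
Proof.
have diagP i j : ((i, j) \in diagonal n) = (i == j) by rewrite inE.
have altP T k : T \in NAR_alt F k -> #|T| = k /\
    forall i j, (i, j) \in T -> i != j /\ (j, i) \in T.
  rewrite inE => /andP[]; rewrite inE => /and3P[_ _ /eqP cT] /forall_inP symT.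
  by split=> // i j /symT /andP[].
apply/idP/and3P => [|[PD /eqP -> /eqP ->]].
  rewrite inE => /andP[]; rewrite inE => /and3P[PF naP _].
  case/exists_inP=> T /altP[cT symT] /existsP[S /and3P[SD /eqP cS /eqP PTS]].
  have symP i j : (i, j) \in P -> (j, i) \in P.
    rewrite PTS !inE => /orP[/symT[_ ->//]|ijS].
    by have := subsetP SD _ ijS; rewrite diagP => /eqP e; subst j; rewrite ijS orbT.
  have TE : P :\: diagonal n = T.
    apply/setP => -[i j]; rewrite PTS in_setD in_setU diagP.
    case ijT: ((i, j) \in T) => /=; first by have [->] := symT _ _ ijT.
    by apply/negP => /andP[ij /(subsetP SD)]; rewrite diagP (negPf ij).
  have SE : P :&: diagonal n = S.
    apply/setP => -[i j]; rewrite PTS in_setI in_setU diagP.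
    case ijS: ((i, j) \in S).
      by have := subsetP SD _ ijS; rewrite diagP => ->; rewrite orbT.
    rewrite orbF; apply/negP => /andP[/symT[ij _] e]; by rewrite e in ij.
  split; last by rewrite SE cS.
    rewrite inE naP /=; apply/andP; split; last first.
      by apply/forall_inP => -[i j]; apply: symP.
    by apply/subsetP => -[i j] /(subsetP PF) ijF; rewrite mem_board ijF !inE.
  by have := card_off_diagonal symP; rewrite TE cT; lia.
have := PD; rewrite inE => /and3P[PF naP _]; have /sym_placementsP[_ _ symP] := PD.
have PFs : P \subset F by apply: subset_trans PF (subsetIl _ _).
have cP := card_off_diagonal symP.
have cardP : #|P| = (2 * upper_count P + #|P :&: diagonal n|)%N.
  by rewrite -cP addnC cardsID.
rewrite inE; apply/andP; split; first by rewrite inE PFs naP cardP /=.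
apply/exists_inP; exists (P :\: diagonal n); last first.
  apply/existsP; exists (P :&: diagonal n).
  by rewrite subsetIr eqxx setUC setID /=.
rewrite inE; apply/andP; split.
  rewrite inE cP eqxx andbT (subset_trans (subsetDl _ _) PFs) /=.
  apply/forall_inP => c /setDP[cP' _]; apply/forall_inP => d /setDP[dP' _].
  exact: (forall_inP (forall_inP naP _ cP') _ dP').
apply/forall_inP => -[i j] /setDP[ijP]; rewrite diagP => ij.
by rewrite ij in_setD diagP eq_sym ij symP.
Qed.

(** Since F is a Ferrers diagram, [ATK P] stays inside F, so attacked cells and inversions add up to
    [#|F|]; the rest is arithmetic of exponents. *)
Lemma placement_weight_setT (R : fieldType) (x : R) n
    (F P : {set 'I_n * 'I_n}) (t s : nat) :
  x != 0 -> is_ferrers F -> P \subset F -> orbit_count P = (t + s)%N ->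
  placement_weight x setT P =
  (x ^+ 2 - 1) ^+ (t + s) * x ^ (#|F|%:Z - t%:Z - s%:Z) *
  x^-1 ^+ rook_inv F P.
Proof.
move=> x0 ferF PF orbE.
have ATKF : ATK P \subset F.
  apply/subsetP => -[i j] /mem_ATK[k [l [/(subsetP PF) klF]]].
  case/orP=> /andP[]; first by move=> ik /eqP->; apply: ferF klF _ _ ik _.
  by move=> /eqP-> jl; apply: ferF klF _ _ _ jl.
have cardF : #|F| = (#|ATK P| + rook_inv F P)%N.
  by rewrite -(cardsID (ATK P) F) (setIidPr ATKF).
rewrite /placement_weight orbE setIC (_ : setX _ _ = setT) ?setTI; last first.
  by apply/setP => c; rewrite !inE.
rewrite cardF -addrA -opprD -PoszD PoszD !expfzDr // -exprnN exprVn expr_div_n.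
have xt0 k : x ^+ k != 0 by rewrite expf_neq0.
rewrite -!exprnP; set y := x ^+ (t + s); set z := x ^+ rook_inv F P.
have y0 : y != 0 by exact: xt0.
have z0 : z != 0 by exact: xt0.
by field; rewrite y0 z0.
Qed.

Lemma Rsym_evalE (R : nzRingType) n (F : {set 'I_n * 'I_n}) (t s : nat) (x : R) :
  Rsym_eval F t s x = \sum_(P in NAR_sym F t s) x ^+ rook_inv F P.
Proof.
rewrite /Rsym_eval /Rsym rmorph_sum horner_sum.
by apply: eq_bigr => P _; rewrite /= map_polyXn hornerXn.
Qed.

(* R only hosts the real number q^(1/2) = Num.sqrt q, so that q^(m/2) is
   Num.sqrt q ^ m for an integer m.  The bounds on t and s in the sum follow
   from 2 * t + s = r. *)
Theorem theorem4p7 (R : rcfType) (q : nat) (Fq : finFieldType)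
    (hq : #|Fq| = q) (n : nat) (hn : (0 < n)%N)
    (F : {set 'I_n * 'I_n}) (hF : is_ferrers F) (hsym : is_symmetric F)
    (r : int) :
  (rank_count (SymMx Fq F) r)%:R =
  \sum_(t < `|r|%N.+1) \sum_(s < `|r|%N.+1 | (2 * t + s)%:Z == r)
    (q%:R - 1) ^+ (t + s)
    * Num.sqrt (q%:R : R) ^ (#|F|%:Z - t%:Z - s%:Z)
    * Rsym_eval F t s (Num.sqrt (q%:R : R))^-1 :> R.
Proof.
set x := Num.sqrt _.
have q0 : 0 < q%:R :> R by rewrite ltr0n -hq; apply: ltnW (card_finRing_gt1 Fq).
have x0 : x != 0 by rewrite sqrtr_eq0 -ltNge.
have x2 : x ^+ 2 = q%:R by rewrite sqr_sqrtr // ltW.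
have FT : F :&: setX setT setT = F.
  by apply/setP => c; rewrite !inE /= andbT.
have symP P : P \in sym_placements F setT ->
    P \subset F /\ #|P| = (2 * upper_count P + #|P :&: diagonal n|)%N.
  move=> PD; have := PD; rewrite inE FT => /and3P[-> _ _]; split=> //.
  have /sym_placementsP[_ _ /card_off_diagonal <-] := PD.
  by rewrite addnC cardsID.
(* The count becomes a sum with [f] the indicator of rank [r]. *)
transitivity (\sum_(A in SymMx Fq F) ((\rank A)%:Z == r)%:R : R).
  rewrite /rank_count -sum1_card natr_sum big_mkcond [RHS]big_mkcond /=.
  apply: eq_bigr => A _; rewrite inE.
  by case: (A \in _) => //=; case: eqP.
rewrite -{1}FT (sum_rank_eq_sum_placements setT (fun k => (k%:Z == r)%:R) x0) ?hq //.
under [RHS]eq_bigr => t _ do under eq_bigr => s _ do rewrite Rsym_evalE big_distrr.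
(* Summing over placements first leaves, for each [P], a sum over pairs [(t, s)] with at most one
   nonzero term. *)
rewrite pair_big_dep /= (exchange_big_dep (mem (sym_placements F setT))) /=; last first.
  by move=> p P _; rewrite mem_NAR_sym => /and3P[].
apply: eq_bigr => P PD; have [PF cardP] := symP P PD.
have [rP|rP] := eqVneq (#|P|%:Z) r; last first.
  rewrite mulr0 big_pred0 // => -[t s] /=; rewrite mem_NAR_sym.
  apply: contraNF rP => /andP[e /and3P[_ /eqP tE /eqP sE]].
  by rewrite cardP -tE -sE.
rewrite mulr1 -x2.
(* Both counts are at most [#|P|], which equals r, so the pair determined by [P] lies within the
   summation bounds. *)
have rE : `|r|%N = #|P| by rewrite -rP.
have tlt : (upper_count P < `|r|.+1)%N by rewrite rE; lia.
have slt : (#|P :&: diagonal n| < `|r|.+1)%N by rewrite rE; lia.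
rewrite (big_pred1 (Ordinal tlt, Ordinal slt)) /=.
  exact: placement_weight_setT (orbit_count_split P).
move=> [t s] /=; rewrite mem_NAR_sym PD xpair_eqE -!val_eqE /=.
apply/andP/andP => [[_ /andP[]//]|[/eqP-> /eqP->]].
by rewrite -cardP rP !eqxx.
Qed.
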